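(* Let $(G,\cdot)$ and $(H,\circ)$ be commutative loops. If there is an isotopism of $G$ upon $H$ of the form $(A,B,B)$ or of the form $(A,B,A)$, then $G$ is a C-loop if and only if $H$ is a C-loop.
   Context: A loop is a quasigroup with a two-sided identity element. Maps are written on the right of their arguments. A triple $(U,V,W)$ of bijections $U,V,W:G\to H$ is an isotopism of the loop $(G,\cdot)$ upon the loop $(H,\circ)$ if $xU\circ yV=(x\cdot y)W$ for all $x,y\in G$. A loop is a C-loop if $x(y(yz))=((xy)y)z$ for all $x,y,z$. *)

(* Defs.v *)
From mathcomp Require Import all_boot.

Set Implicit Arguments.
Unset Strict Implicit.
Unset Printing Implicit Defensive.

Definition quasigroup (T : Type) (op : T -> T -> T) : Prop :=
  (forall a b : T, exists! x, op a x = b) /\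
  (forall a b : T, exists! y, op y a = b).

Definition is_loop (T : Type) (op : T -> T -> T) : Prop :=
  quasigroup op /\ exists e : T, left_id e op /\ right_id e op.

Definition commutative_loop (T : Type) (op : T -> T -> T) : Prop :=
  is_loop op /\ commutative op.

Definition C_loop (T : Type) (op : T -> T -> T) : Prop :=
  is_loop op /\
  forall x y z : T, op x (op y (op y z)) = op (op (op x y) y) z.

(* The right-hand map notation x U of loop theory is written U x. *)
Definition isotopism (G H : Type) (opG : G -> G -> G) (opH : H -> H -> H)
    (U V W : G -> H) : Prop :=
  [/\ bijective U, bijective V, bijective W &
      forall x y : G, opH (U x) (V y) = W (opG x y)].

(* Main.v *)
(* If [U(x) o V(y) = V(x y)], setting [y = 1] gives [V(x) = U(x) o b] with
   [b = V(1)], and commutativity of [G] then says exactly that [b] is in the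
   middle nucleus of [H]. A C-loop has the inverse property, under which the
   middle nucleus is contained in the left one; with commutativity,
   [U(x y) o b = (U(x) o U(y)) o b], so [U] is an isomorphism. The inverse of an
   isotopism [(U, V, V)] has the same form, and commutativity turns [(U, V, U)]
   into [(V, U, U)]. *)
Require Import Defs.
From mathcomp Require Import all_boot.

Set Implicit Arguments.
Unset Strict Implicit.
Unset Printing Implicit Defensive.

Lemma quasigroup_mulI (T : Type) (op : T -> T -> T) (a : T) :
  quasigroup op -> injective (op a).
Proof.
case=> div _ x y eq_ax_ay; have [z [_ uniq_z]] := div a (op a y).
by rewrite -(uniq_z x eq_ax_ay); apply: uniq_z.
Qed.

Lemma comm_C_loop_inverse (T : Type) (op : T -> T -> T) (y : T) :
  commutative op -> C_loop op ->
  exists y', cancel (op y) (op y') /\ cancel (op y') (op y).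
Proof.
move=> opC [[[div _] [e [op1x _]]] C].
have cancel_inv u v : op v u = e -> cancel (op u) (op v).
  (* Writing [w] as [u z] makes the C-law apply: v(u(uz)) = ((vu)u)z = uz. *)
  by move=> vu1 w; have [z [<- _]] := div u w; rewrite C vu1 op1x.
have [y' [yy'1 _]] := div y e.
by exists y'; split; apply: cancel_inv; rewrite // opC.
Qed.

Lemma comm_C_loop_middle_left_nucleus (T : Type) (op : T -> T -> T) (b : T) :
  commutative op -> C_loop op ->
  (forall x y, op (op y b) x = op y (op b x)) ->
  forall u w, op (op b u) w = op b (op u w).
Proof.
move=> opC C_T middle_b u w.
have [u' [uK _]] := comm_C_loop_inverse u opC C_T.
have [v [vK vVK]] := comm_C_loop_inverse (op b u) opC C_T.
have bu_u' : op (op b u) u' = b.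
  by rewrite opC (opC b) uK.
have vb : op v b = u' by rewrite -{1}bu_u' vK.
(* As w = u'(uw) and u' = vb, (bu)w = (bu)((vb)(uw)) = (bu)(v(b(uw))), where [bu] cancels its
   inverse [v]. *)
by rewrite -[in LHS](uK w) -vb middle_b vVK.
Qed.

Lemma isotopism_comm_C_loop_morph (G H : Type) (opG : G -> G -> G)
    (opH : H -> H -> H) (U V : G -> H) :
  commutative_loop opG -> commutative opH -> C_loop opH ->
  isotopism opG opH U V V -> {morph U : x y / opG x y >-> opH x y}.
Proof.
move=> [[_ [e [_ opGx1]]] opGC] opHC C_H [[U' _ U'K] _ _ UV].
have VE x : V x = opH (U x) (V e) by rewrite UV opGx1.
have middle x y : opH (opH y (V e)) x = opH y (opH (V e) x).
  rewrite -(U'K x) -(U'K y) -VE (opHC (V e)) -VE (opHC (V _)) !UV.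
  by rewrite opGC.
have left := comm_C_loop_middle_left_nucleus opHC C_H middle.
have [[quasi_H _] _] := C_H => x y.
(* With b = [V e]: b U(xy) = V(xy) = U(x)V(y) = (b U(y))U(x) = b(U(y)U(x)), the last step by
   [left]. *)
apply: (quasigroup_mulI (a := V e) quasi_H).
by rewrite opHC -VE -UV VE (opHC (U x)) (opHC (U y)) left (opHC (U y)).
Qed.

(** The C-law, being an identity, pulls back along the injective morphism [U]. *)
Lemma isotopism_comm_C_loop (G H : Type) (opG : G -> G -> G)
    (opH : H -> H -> H) (U V : G -> H) :
  commutative_loop opG -> commutative opH -> isotopism opG opH U V V ->
  C_loop opH -> C_loop opG.
Proof.
move=> loopG opHC iso C_H.
have UM := isotopism_comm_C_loop_morph loopG opHC C_H iso.
split=> [|x y z]; first by case: loopG.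
have [/bij_inj U_inj _ _ _] := iso.
by apply: U_inj; rewrite !UM; case: C_H => _ ->.
Qed.

Lemma isotopism_inv (G H : Type) (opG : G -> G -> G) (opH : H -> H -> H)
    (U V : G -> H) :
  isotopism opG opH U V V -> exists U' V', isotopism opH opG U' V' V'.
Proof.
move=> [[U' UK U'K] [V' VK V'K] _ UV]; exists U', V'.
split; [by exists U | by exists V | by exists V |] => x y.
by rewrite -{2}(U'K x) -{2}(V'K y) UV VK.
Qed.

Theorem theorem3p9 (G H : Type) (opG : G -> G -> G) (opH : H -> H -> H)
    (hG : commutative_loop opG) (hH : commutative_loop opH)
    (hiso : (exists A B : G -> H, isotopism opG opH A B B) \/
            (exists A B : G -> H, isotopism opG opH A B A)) :
  C_loop opG <-> C_loop opH.
Proof.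
have [opGC opHC] : commutative opG /\ commutative opH by case: hG; case: hH.
have [U [V iso]] : exists U V, isotopism opG opH U V V.
  case: hiso => [//|[A [B [bijA bijB _ AB]]]]; exists B, A.
  by split=> // x y; rewrite opHC AB opGC.
have [U' [V' iso']] := isotopism_inv iso.
(* The C-law passes only from target to source, so the forward direction uses the inverse
   isotopism. *)
split; first exact: isotopism_comm_C_loop hH opGC iso'.
exact: isotopism_comm_C_loop hG opHC iso.
Qed.
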